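(* Let $n\geq 5$ and let $T$ be an $n$-tournament. Then $T$ is $(n-2)$-spectrally monomorphic if and only if $T$ is transitive or doubly regular. Moreover, if $T$ is doubly regular, then the common characteristic polynomial of the adjacency matrices of all the $(n-2)$-vertex subtournaments of $T$ is \[ \left(z^{2}+z+\tfrac{n+1}{4}\right)^{\frac{n-5}{2}}\left(z^{3}-\tfrac{n-5}{2}z^{2}-\tfrac{n-5}{2}z-\tfrac{n-3}{4}\right). \]
   Context: An $n$-tournament is a digraph on $n$ vertices in which every pair of distinct vertices is joined by exactly one arc; if the arc goes from $u$ to $v$, $u$ dominates $v$. With respect to an ordering $v_1,\dots,v_n$ of the vertices, the adjacency matrix $A=(a_{ij})$ has $a_{ij}=1$ if $v_i$ dominates $v_j$ and $0$ otherwise. The characteristic polynomial of a square matrix $M$ is $P_M(z)=\det(zI-M)$. A square matrix is $k$-spectrally monomorphic if all its $k\times k$ principal submatrices have the same characteristic polynomial; a tournament is $k$-spectrally monomorphic if its adjacency matrix is (equivalently, all its $k$-vertex subtournaments have adjacency matrices with the same characteristic polynomial). A tournament is transitive if whenever $u$ dominates $v$ and $v$ dominates $w$, then $u$ dominates $w$. A tournament is doubly regular if the number $|N^+(x)\cap N^+(y)|$ of vertices dominated by both $x$ and $y$ is the same for all pairs of distinct vertices $x,y$, where $N^+(x)$ is the set of vertices dominated by $x$. *)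

(* Defs.v *)
From HB Require Import structures.
From mathcomp Require Import all_boot all_order all_algebra.
Set Implicit Arguments. Unset Strict Implicit. Unset Printing Implicit Defensive.
Import Order.TTheory GRing.Theory Num.Theory.
Local Open Scope ring_scope.

(* A tournament on the vertex set 'I_n, given by its domination relation:
   T u v means "u dominates v". *)
Definition is_tournament (n : nat) (T : rel 'I_n) : Prop :=
  (forall u, ~~ T u u) /\ (forall u v, u != v -> T u v = ~~ T v u).

Definition adjmx (n : nat) (T : rel 'I_n) : 'M[rat]_n :=
  \matrix_(i, j) (T i j)%:R.

Definition principal_submx (R : Type) (n k : nat) (f : 'I_k -> 'I_n)
  (A : 'M[R]_n) : 'M[R]_k := \matrix_(i, j) A (f i) (f j).

Definition increasing (n k : nat) (f : 'I_k -> 'I_n) : Prop :=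
  forall i j : 'I_k, (i < j)%N -> (f i < f j)%N.

Definition spectrally_monomorphic (R : comNzRingType) (n k : nat) (A : 'M[R]_n) : Prop :=
  forall f g : 'I_k -> 'I_n, increasing f -> increasing g ->
    char_poly (principal_submx f A) = char_poly (principal_submx g A).

Definition transitive_tournament (n : nat) (T : rel 'I_n) : Prop :=
  forall u v w, T u v -> T v w -> T u w.

Definition doubly_regular (n : nat) (T : rel 'I_n) : Prop :=
  exists c : nat, forall x y : 'I_n, x != y ->
    #|[set z | T x z && T y z]| = c.

(* The polynomial of the theorem; the exponent (n-5)/2 is a natural number
   (a doubly regular tournament has n = 3 mod 4). *)
Definition dr_poly (n : nat) : {poly rat} :=
  ('X ^+ 2 + 'X + ((n.+1)%:R / 4)%:P) ^+ ((n - 5)./2) *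
  ('X ^+ 3 - ((n - 5)%:R / 2)%:P * 'X ^+ 2 - ((n - 5)%:R / 2)%:P * 'X
   - ((n - 3)%:R / 4)%:P).

(* Main.v *)
Require Import Defs.
From HB Require Import structures.
From mathcomp Require Import all_boot all_order all_algebra.
From mathcomp Require Import all_fingroup algC ring lra zify.
Import Order.TTheory GRing.Theory Num.Theory.
Set Implicit Arguments. Unset Strict Implicit. Unset Printing Implicit Defensive.
Local Open Scope ring_scope.

(** If all the principal submatrices [A_S] with [|S| = n - 2] share their
    characteristic polynomial, they share [tr (A_S ^ 3)], which counts the
    3-cycles inside [S] (three times each). By inclusion-exclusion, the number
    of 3-cycles through a pair [{x, y}] is [C + d x + d y], where [d] counts
    the 3-cycles through a vertex; summing over [y] shows that [d] is constant
    (here [n > 4]), hence every arc lies in the same number [t] of 3-cycles.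
    If [t = 0], the tournament is transitive. Otherwise the 3-cycles through
    [x], counted along the arcs leaving and entering [x], number
    [t * outdeg x = t * indeg x], so the tournament is regular, and then
    constancy of [t] is double regularity.

    Conversely, a transitive tournament has a strictly triangular adjacency
    matrix up to reordering. In a doubly regular tournament [n = 4c + 3], and
    with [q = X^2 + X + c + 1] and [l = X - (2c + 1)] one has
    [(X - A)(X - A^T) = q I + (c - X) J] and
    [(X - A)(l (X + 1 + A) + (c + 1) J) = q l I]. The first identity gives
    [det (X - A) = l q ^ (2c + 1)]; Jacobi's complementary minor formula,
    applied to the second, gives the minors of order [n - 2] of [X - A]. *)

(** * Traces of powers are determined by the characteristic polynomial *)

Lemma trig_mulmx (R : pzRingType) n (A B : 'M[R]_n) :
  is_trig_mx A -> is_trig_mx B ->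
  is_trig_mx (A *m B) /\ (forall i, (A *m B) i i = A i i * B i i).
Proof.
move=> /is_trig_mxP A0 /is_trig_mxP B0; split.
  apply/is_trig_mxP => i j ij; rewrite mxE big1 // => k _.
  have [ik|ki] := ltnP i k; first by rewrite A0 ?mul0r.
  by rewrite B0 ?mulr0 //; apply: leq_ltn_trans ij.
move=> i; rewrite mxE (bigD1 i) //= big1 ?addr0 // => k ki.
have [ik|] := ltnP i k; first by rewrite A0 ?mul0r.
rewrite leq_eqVlt => /orP[/eqP e|{}ki]; last by rewrite B0 ?mulr0.
by case/eqP: ki; apply: val_inj.
Qed.

Lemma trig_expmx (R : pzRingType) n (A : 'M[R]_n) k : is_trig_mx A ->
  is_trig_mx (A ^+ k) /\ (forall i, (A ^+ k) i i = A i i ^+ k).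
Proof.
move=> At; elim: k => [|k [IHt IHd]].
  by split=> [|i]; rewrite !expr0 ?scalar_mx_is_trig // mxE eqxx.
have [Mt Md] := trig_mulmx At IHt.
by split=> [|i]; rewrite exprS -?mulmxE // Md IHd exprS.
Qed.

(** The intertwining relation lifts to the characteristic matrices, and the nonzero constant
    [\det P] cancels. *)
Lemma simmx_char_poly (F : fieldType) n (P A L : 'M[F]_n) :
  P \in unitmx -> P *m A = L *m P -> char_poly A = char_poly L.
Proof.
move=> Pu PA; pose Q := map_mx polyC P.
have Qu : \det Q != 0.
  by rewrite /Q det_map_mx polyC_eq0 -unitfE -unitmxE.
have e : Q *m char_poly_mx A = char_poly_mx L *m Q.
  by rewrite /char_poly_mx mulmxBr mulmxBl -!map_mxM PA scalar_mxC.
by apply: (mulfI Qu); rewrite /char_poly -det_mulmx e det_mulmx mulrC.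
Qed.

(** By Schur's theorem [A] is similar to a triangular matrix: its diagonal lists the roots [r], and
    the diagonals of its powers list the powers of the roots. *)
Lemma char_poly_closed_mxtrace (C : numClosedFieldType) n (A : 'M[C]_n.+1) :
  exists2 r : seq C, char_poly A = \prod_(x <- r) ('X - x%:P) &
    forall k, \tr (A ^+ k) = \sum_(x <- r) x ^+ k.
Proof.
have [P /unitarymx_unit Pu] := Schur A (ltn0Sn n).
set L := conjmx P A => Lt.
have PA : P *m A = L *m P by apply/(similarP Pu); rewrite /similar_to /= eqxx.
exists [seq L i i | i <- index_enum 'I_n.+1] => [|k].
  by rewrite (simmx_char_poly Pu PA) big_map char_poly_trig.
have PAk : P *m A ^+ k = L ^+ k *m P.
  elim: k => [|k IH]; first by rewrite mul1mx mulmx1.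
  by rewrite !exprS -!mulmxE mulmxA PA -mulmxA IH mulmxA.
have -> : A ^+ k = invmx P *m (L ^+ k *m P) by rewrite -PAk mulKmx.
rewrite mxtrace_mulC mulmxK // big_map; apply: eq_bigr => i _.
by rewrite (trig_expmx k Lt).2.
Qed.

(** Over [algC] the polynomial determines its multiset of roots, hence their power sums; [ratr] is
    injective, so the equality descends to [rat]. *)
Lemma eq_char_poly_mxtrace n (A B : 'M[rat]_n.+1) k :
  char_poly A = char_poly B -> \tr (A ^+ k) = \tr (B ^+ k).
Proof.
move=> AB; pose f := ratr : rat -> algC.
have [r rA tA] := char_poly_closed_mxtrace (map_mx f A).
have [s sB tB] := char_poly_closed_mxtrace (map_mx f B).
have /prod_XsubC_eq rs : \prod_(x <- r) ('X - x%:P) = \prod_(x <- s) ('X - x%:P).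
  by rewrite -rA -sB -!map_char_poly AB.
apply: (fmorph_inj f); rewrite -!trace_map_mx !rmorphXn /= tA tB.
exact: perm_big.
Qed.

(** * Summation over all vertices but two *)

Lemma enum_set_increasing n k (S : {set 'I_n}) (x0 : 'I_n) : #|S| = k ->
  increasing (fun i : 'I_k => nth x0 (enum S) i).
Proof.
move=> Sk i j ij.
have srt : sorted ltn (map val (enum S)).
  rewrite -[enum _](eq_filter (mem_enum _)).
  rewrite -(eq_filter (mem_map val_inj _)) -filter_map.
  by rewrite (sorted_filter ltn_trans) // unlock val_ord_enum iota_ltn_sorted.
have sz : size (enum S) = k by rewrite -cardE.
have := sorted_ltn_nth ltn_trans 0 srt; move/(_ i j).
by rewrite !inE size_map sz !ltn_ord !(nth_map x0) ?sz ?ltn_ord //; apply.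
Qed.

(** [f] enumerates the complement of the pair in increasing order; its effect on sums is what the
    inclusion-exclusion on 3-cycles uses. *)
Lemma increasing_avoiding_pair n (x y : 'I_n) : x != y ->
  exists2 f : 'I_(n - 2) -> 'I_n, increasing f &
    forall (V : zmodType) (F : 'I_n -> V),
      \sum_(i < n - 2) F (f i) = \sum_i F i - F x - F y.
Proof.
move=> xy; pose S := ~: [set x; y].
have Sk : #|S| = (n - 2)%N by rewrite cardsCs setCK cards2 xy card_ord.
exists (fun i : 'I_(n - 2) => nth x (enum S) i) => [|V F].
  exact: enum_set_increasing.
have -> : \sum_(i < n - 2) F (nth x (enum S) i) = \sum_(i in S) F i.
  by rewrite -[in RHS]big_enum (big_nth x) big_mkord -cardE Sk.
rewrite [in RHS](bigD1 x) //= [in RHS](bigD1 y) 1?eq_sym //=.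
have addKK (u v w : V) : u + (v + w) - u - v = w.
  by rewrite (addrC u) addrK (addrC v) addrK.
by rewrite addKK; apply: eq_bigl => i; rewrite !inE negb_or.
Qed.

(** * Counting 3-cycles *)

Lemma mxtrace_cube (R : pzRingType) n (A : 'M[R]_n.+1) :
  \tr (A ^+ 3) = \sum_i \sum_j \sum_k A i j * A j k * A k i.
Proof.
rewrite exprSr expr2 -!mulmxE; apply: eq_bigr => i _.
rewrite mxE exchange_big /=; apply: eq_bigr => k _.
by rewrite mxE mulr_suml.
Qed.

Section ThreeCycles.
Variables (R : comNzRingType) (n : nat) (a : 'I_n -> 'I_n -> R).
Hypothesis a_irr : forall i, a i i = 0.

(** When [a] is the adjacency matrix of a tournament, [cyc3 i j k] is the indicator of a 3-cycle
    from [i] to [j] to [k]. Each 3-cycle through the arc from [i] to [j] then counts once in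
    [cyc3_arc i j], and each one through [i] once in [cyc3_vtx i]. *)
Definition cyc3 (i j k : 'I_n) := a i j * a j k * a k i.
Definition cyc3_arc i j := \sum_k cyc3 i j k.
Definition cyc3_vtx i := \sum_j cyc3_arc i j.

Lemma cyc3C i j k : cyc3 i j k = cyc3 j k i.
Proof. by rewrite /cyc3 -mulrA mulrC. Qed.

Lemma cyc3_id i j : (cyc3 i i j = 0) * (cyc3 i j i = 0) * (cyc3 j i i = 0).
Proof. by rewrite /cyc3 a_irr !(mulr0, mul0r). Qed.

Lemma sum_cyc3_arcr x : \sum_i cyc3_arc i x = cyc3_vtx x.
Proof.
rewrite /cyc3_vtx /cyc3_arc [RHS]exchange_big /=.
by apply: eq_bigr => i _; apply: eq_bigr => k _; rewrite cyc3C.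
Qed.

(** Inclusion-exclusion, with [del] standing for summation over the vertices other than [x] and [y].
    The factors 3 come from the three rotations of a cycle; terms with a repeated index vanish. *)
Lemma sum_cyc3_avoiding (x y : 'I_n) (del : ('I_n -> R) -> R) :
  (forall F, del F = \sum_i F i - F x - F y) ->
  del (fun i => del (fun j => del (fun k => cyc3 i j k))) =
  \sum_i cyc3_vtx i - 3%:R * (cyc3_vtx x + cyc3_vtx y)
  + 3%:R * (cyc3_arc x y + cyc3_arc y x).
Proof.
move=> delE; rewrite delE.
have E1 i j : del (fun k => cyc3 i j k) = cyc3_arc i j - cyc3 x i j - cyc3 y i j.
  by rewrite delE !(cyc3C _ i j).
have E2 i : del (fun j => del (fun k => cyc3 i j k)) =
    cyc3_vtx i - cyc3_arc x i - cyc3_arc y i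
   - (cyc3_arc i x - cyc3 x i x - cyc3 y i x)
   - (cyc3_arc i y - cyc3 x i y - cyc3 y i y).
  by rewrite delE !E1; under eq_bigr do rewrite E1; rewrite !sumrB.
rewrite !E2; under eq_bigr do rewrite E2; rewrite !sumrB !sum_cyc3_arcr.
rewrite /= !cyc3_id.
have -> : \sum_i cyc3 x i x = 0 by apply: big1 => i _; rewrite cyc3_id.
have -> : \sum_i cyc3 y i y = 0 by apply: big1 => i _; rewrite cyc3_id.
have -> : \sum_i cyc3 y i x = cyc3_arc x y.
  by apply: eq_bigr => i _; rewrite -cyc3C.
have -> : \sum_i cyc3 x i y = cyc3_arc y x.
  by apply: eq_bigr => i _; rewrite -cyc3C.
have -> : cyc3_arc x x = 0 by apply: big1 => i _; rewrite cyc3_id.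
have -> : cyc3_arc y y = 0 by apply: big1 => i _; rewrite cyc3_id.
rewrite -/(cyc3_vtx x) -/(cyc3_vtx y).
ring.
Qed.

End ThreeCycles.

Lemma eq_cyc3_arc m (A : 'M[rat]_m.+3.+2) (x y x' y' : 'I_m.+3.+2) :
  (forall i, A i i = 0) -> spectrally_monomorphic (m.+3.+2 - 2) A ->
  x != y -> x' != y' ->
  cyc3_arc A x y + cyc3_arc A y x = cyc3_arc A x' y' + cyc3_arc A y' x'.
Proof.
move=> A0 mono.
pose t := \sum_i cyc3_vtx A i.
have [C CE] : exists C, forall x y, x != y ->
   cyc3_arc A x y + cyc3_arc A y x = C + cyc3_vtx A x + cyc3_vtx A y.
  pose tr x y := t - 3%:R * (cyc3_vtx A x + cyc3_vtx A y)
     + 3%:R * (cyc3_arc A x y + cyc3_arc A y x).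
  have trE x1 y1 x2 y2 : x1 != y1 -> x2 != y2 -> tr x1 y1 = tr x2 y2.
    move=> xy1 xy2.
    have [f f_inc fE] := increasing_avoiding_pair xy1.
    have [g g_inc gE] := increasing_avoiding_pair xy2.
    (* [m.+3.+2 - 2] is convertible to the successor [m.+3], so that powers of the submatrix make
       sense. *)
    have trf (h : 'I_(m.+3.+2 - 2) -> 'I_m.+3.+2) :
        \tr ((principal_submx h A : 'M_m.+3) ^+ 3) = \sum_(i < m.+3.+2 - 2)
          \sum_(j < m.+3.+2 - 2) \sum_(k < m.+3.+2 - 2) cyc3 A (h i) (h j) (h k).
      rewrite mxtrace_cube.
      by do 3!(apply: eq_bigr => ? _); rewrite !mxE.
    rewrite /tr /t -(sum_cyc3_avoiding A0 (fE rat)) -(sum_cyc3_avoiding A0 (gE rat)).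
    rewrite -!trf; apply: eq_char_poly_mxtrace; exact: mono.
  exists ((tr ord0 ord_max - t) / 3%:R) => x1 y1 xy1.
  rewrite (@trE ord0 ord_max x1 y1) // /tr.
  by field.
(* Summing the pair identity over [y1 != x1] gives [2 d = (n - 1) (C + d) + (t - d)] for
   [d = cyc3_vtx A x1] and [n = m + 5]; the resulting coefficient [n - 4 = m + 1] of [d] is
   nonzero. *)
have vC x1 : (m.+1)%:R * cyc3_vtx A x1 = - (m.+4%:R * C + t).
  have : \sum_(y1 | y1 != x1) (cyc3_arc A x1 y1 + cyc3_arc A y1 x1) =
         \sum_(y1 | y1 != x1) (C + cyc3_vtx A x1 + cyc3_vtx A y1).
    by apply: eq_bigr => y1 yx; rewrite CE // eq_sym.
  have arc0 : cyc3_arc A x1 x1 = 0 by apply: big1 => k _; rewrite cyc3_id.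
  have -> : \sum_(y1 | y1 != x1) (cyc3_arc A x1 y1 + cyc3_arc A y1 x1) =
            2%:R * cyc3_vtx A x1.
    rewrite mulr_natl mulr2n -[X in _ = _ + X]sum_cyc3_arcr -big_split /=.
    by rewrite [RHS](bigD1 x1) //= arc0 !add0r.
  rewrite big_split sumr_const cardC1 card_ord /=.
  have -> : \sum_(i | i != x1) cyc3_vtx A i = t - cyc3_vtx A x1.
    by rewrite /t [in RHS](bigD1 x1) //= addrAC subrr add0r.
  rewrite -[(C + _) *+ _]mulr_natl -[m.+4%:R]natr1 -[m.+3%:R]natr1 -[m.+2%:R]natr1.
  have lin (M v u w : rat) : 2%:R * v = (M + 1 + 1 + 1) * (u + v) + (w - v) ->
      M * v = - ((M + 1 + 1 + 1) * u + w) by move=> e; lra.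
  exact: lin.
have vE x1 x2 : cyc3_vtx A x1 = cyc3_vtx A x2.
  have m0 : (m.+1)%:R != 0 :> rat by rewrite pnatr_eq0.
  by apply: (mulfI m0); rewrite !vC.
by move=> xy xy'; rewrite !CE // (vE x x') (vE y y').
Qed.

(** * Outdegrees and common out-neighbours in a tournament *)

Section Tournament.
Variables (n : nat) (T : rel 'I_n).
Hypothesis tourT : is_tournament T.
Let A := adjmx T.

Lemma adjmxE i j : A i j = (T i j)%:R.
Proof. by rewrite mxE. Qed.

Lemma adjmx_diag i : A i i = 0.
Proof. by rewrite mxE (negbTE (tourT.1 i)). Qed.

Lemma adjmx_add i j : A i j + A j i = 1 - (i == j)%:R.
Proof.
rewrite !mxE; have [->|ij] := eqVneq i j.
  by rewrite (negbTE (tourT.1 j)) addr0 subrr.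
by rewrite (tourT.2 _ _ ij); case: (T j i); rewrite ?subr0 ?addr0 ?add0r.
Qed.

Lemma tournament_asym i j : T i j -> ~~ T j i.
Proof.
have [->|ij] := eqVneq i j; first by rewrite (negbTE (tourT.1 j)).
by rewrite (tourT.2 _ _ ij).
Qed.

Lemma sum_delta (F : 'I_n -> rat) x : \sum_z F z * (x == z)%:R = F x.
Proof.
rewrite (bigD1 x) //= eqxx mulr1 big1 ?addr0 // => z.
by rewrite eq_sym => /negbTE ->; rewrite mulr0.
Qed.

Definition outdeg x := \sum_z A x z.
Definition common_out x y := \sum_z A x z * A y z.

Lemma common_outC x y : common_out x y = common_out y x.
Proof. by apply: eq_bigr => z _; rewrite mulrC. Qed.

Lemma common_out_card x y : common_out x y = #|[set z | T x z && T y z]|%:R.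
Proof.
rewrite -sum1_card natr_sum big_mkcond /=; apply: eq_bigr => z _.
by rewrite inE !mxE -natrM mulnb; case: (_ && _).
Qed.

Lemma common_outxx x : common_out x x = outdeg x.
Proof. by apply: eq_bigr => z _; rewrite mxE -natrM mulnb andbb. Qed.

Lemma sum_indeg x : \sum_z A z x = n%:R - 1 - outdeg x.
Proof.
apply/eqP; rewrite eq_sym subr_eq; apply/eqP; rewrite -big_split /=.
under eq_bigr => z _ do rewrite adjmx_add eq_sym -[(x == z)%:R]mul1r.
by rewrite sumrB sum_delta sumr_const card_ord.
Qed.

Lemma cyc3_arcE x y : T x y -> cyc3_arc A x y = outdeg y - common_out x y.
Proof.
move=> Txy; have Ayx : A y x = 0 by rewrite mxE (negbTE (tournament_asym Txy)).
(* The zero term [A y x] is inserted to match the diagonal term of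
   [A z x = 1 - (x == z) - A x z]. *)
rewrite -[outdeg y]subr0 -{1}Ayx -(sum_delta (A y) x) -!sumrB.
apply: eq_bigr => z _; rewrite /cyc3 adjmxE Txy mul1r.
have -> : A z x = 1 - (x == z)%:R - A x z.
  by rewrite -adjmx_add addrC addKr.
by rewrite !mulrBr mulr1 [A y z * A x z]mulrC.
Qed.

Lemma cyc3_arc0 x y : T x y -> cyc3_arc A y x = 0.
Proof.
move=> /tournament_asym /negbTE Tyx; apply: big1 => k _.
by rewrite /cyc3 adjmxE Tyx !mul0r.
Qed.

Lemma eq_cyc3_arc_transitive_or_dr d :
  (forall x y, x != y -> cyc3_arc A x y + cyc3_arc A y x = d) ->
  transitive_tournament T \/ doubly_regular T.
Proof.
move=> dE; have arcE x y : T x y -> cyc3_arc A x y = d.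
  move=> Txy; rewrite -(dE x y) ?(cyc3_arc0 Txy) ?addr0 //.
  by apply: contraTneq Txy => ->; rewrite (negbTE (tourT.1 y)).
have [d0|dn0] := eqVneq d 0; [left|right].
  (* If [w] dominated [u], the cycle on [u], [v], [w] would add 1 to a vanishing sum of nonnegative
     terms. *)
  move=> u v w Tuv Tvw; apply: contraT => Tuw.
  have uw : w != u by apply: contraTneq Tvw => ->; apply: tournament_asym.
  have Twu : T w u by rewrite (tourT.2 _ _ uw).
  have /psumr_eq0P : cyc3_arc A u v = 0 by rewrite arcE.
  have c0 k : true -> 0 <= cyc3 A u v k by rewrite /cyc3 !mxE !mulr_ge0.
  move=> /(_ c0 w isT) /eqP.
  by rewrite /cyc3 !mxE Tuv Tvw Twu !mulr1 oner_eq0.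
have arcM x y : cyc3_arc A x y = d * A x y.
  rewrite adjmxE; case: (boolP (T x y)) => Txy; first by rewrite mulr1 arcE.
  by rewrite mulr0 /cyc3_arc big1 // => k _; rewrite /cyc3 adjmxE (negbTE Txy) !mul0r.
have out_in x : outdeg x = \sum_z A z x.
  apply: (mulfI dn0); rewrite !mulr_sumr.
  transitivity (cyc3_vtx A x); first by apply: eq_bigr => z _; rewrite arcM.
  by rewrite -sum_cyc3_arcr; apply: eq_bigr => z _; rewrite arcM.
have outE x : outdeg x = (n%:R - 1) / 2.
  by have := out_in x; rewrite sum_indeg => e; lra.
have comE x y : T x y -> common_out x y = (n%:R - 1) / 2 - d.
  by move=> Txy; have := cyc3_arcE Txy; rewrite arcE // outE => e; lra.
have comE' x y : x != y -> common_out x y = (n%:R - 1) / 2 - d.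
  move=> xy; case: (boolP (T x y)) => Txy; first exact: comE.
  by rewrite common_outC; apply: comE; rewrite (tourT.2 y x) // eq_sym.
(* A natural number is required; truncation is exact because, given a pair [x != y], the value is a
   cardinality. *)
exists (Num.truncn ((n%:R - 1) / 2 - d : rat)) => x y xy.
by rewrite -(comE' x y xy) common_out_card natrK.
Qed.

(** Each outdegree is 0 or [2c + 1]. An outdegree 0 would force [c = 0], hence all outdegrees at
    most 1, too few arcs when [n >= 5]. So all are [2c + 1], and counting arcs gives
    [n - 1 = 2 (2c + 1)]. *)
Lemma doubly_regular_outdeg c : (5 <= n)%N ->
  (forall x y, x != y -> common_out x y = c%:R) ->
  n = (4 * c + 3)%N /\ (forall x, outdeg x = (2 * c + 1)%:R).
Proof.
move=> n5 cE.
(* [c * outdeg x] counts the arcs inside the out-neighbourhood of [x]. *)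
have quad x : outdeg x * (outdeg x - 1 - 2%:R * c%:R) = 0.
  have S1 : \sum_y \sum_z A x y * A x z * A y z = c%:R * outdeg x.
    rewrite mulr_sumr; apply: eq_bigr => y _.
    transitivity (A x y * common_out x y).
      by rewrite mulr_sumr; apply: eq_bigr => z _; rewrite mulrA.
    have [<-|xy] := eqVneq x y; first by rewrite adjmx_diag mul0r mulr0.
    by rewrite cE // mulrC.
  have S2 : \sum_y \sum_z A x y * A x z * A z y = c%:R * outdeg x.
    rewrite -S1 exchange_big /=; apply: eq_bigr => y _; apply: eq_bigr => z _.
    by rewrite [A x z * _]mulrC.
  have S3 : \sum_y \sum_z A x y * A x z * (A y z + A z y) =
      outdeg x * outdeg x - outdeg x.
    rewrite {1}/outdeg mulr_suml -[X in _ = _ - X]common_outxx -sumrB.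
    apply: eq_bigr => y _; rewrite -[X in _ - _ * X](sum_delta (A x) y) /outdeg.
    rewrite !mulr_sumr -sumrB; apply: eq_bigr => z _.
    by rewrite adjmx_add; ring.
  have : 2%:R * (c%:R * outdeg x) = outdeg x * outdeg x - outdeg x.
    rewrite -S3 mulr_natl mulr2n -{1}S1 -S2 -big_split /=.
    apply: eq_bigr => y _; rewrite -big_split /=; apply: eq_bigr => z _.
    by rewrite mulrDr.
  move=> e; lra.
have total : 2%:R * (\sum_x outdeg x) = n%:R * (n%:R - 1).
  have outE : \sum_x outdeg x = \sum_x \sum_z A z x by rewrite exchange_big.
  rewrite mulr_natl mulr2n {1}outE -big_split /=.
  under eq_bigr => x _ do rewrite sum_indeg subrK.
  by rewrite sumr_const card_ord -[LHS]mulr_natl.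
have n0 : (0 < n)%N by lia.
have outdegE x : outdeg x = (2 * c + 1)%:R.
  have /eqP := quad x; rewrite mulf_eq0 => /orP[|/eqP e]; last first.
    by rewrite natrD natrM; lra.
  move=> /eqP ox0.
  have [y yx] : exists y, y != x.
    apply/existsP; rewrite -negb_forall; apply/negP => /forallP xE.
    have n1 : n = 1%N.
      rewrite -[n]card_ord; apply: (@eq_card1 _ x) => z.
      by rewrite !inE; apply/esym/xE.
    by rewrite n1 in n5.
  have c0 : c%:R = 0 :> rat.
    apply/le_anti; rewrite ler0n andbT -(cE x y) 1?eq_sym // -[leRHS]ox0.
    by apply: ler_sum => z _; rewrite !mxE -natrM ler_nat; case: (T x z); case: (T y z).
  have out_le1 z : outdeg z <= 1.
    have /eqP := quad z; rewrite c0 mulf_eq0 => /orP[/eqP ->|/eqP e] //; lra.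
  have : 2%:R * \sum_x outdeg x <= 2%:R * n%:R.
    rewrite ler_wpM2l // -[n in n%:R]card_ord -sumr_const; exact: ler_sum.
  have : 5%:R <= n%:R :> rat by rewrite ler_nat.
  rewrite total; nra.
split=> //.
move: total; under eq_bigr => x _ do rewrite outdegE.
rewrite sumr_const card_ord -[_ *+ n]mulr_natl => e.
have n0' : n%:R != 0 :> rat by rewrite pnatr_eq0 -lt0n.
have e' : n%:R = (4 * c + 3)%:R :> rat.
  move: e; rewrite mulrCA => /(mulfI n0'). 
  rewrite (natrD _ (2 * c)%N) (natrD _ (4 * c)%N) (natrM _ 2) (natrM _ 4) => e; lra.
by apply/eqP; rewrite -(eqr_nat rat) e'.
Qed.

End Tournament.

(** * Determinant identities *)

Lemma det_scalar_add_const (R : idomainType) n (a b : R) : a != 0 ->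
  \det (a%:M + const_mx b : 'M_n.+1) = a ^+ n * (a + n.+1%:R * b).
Proof.
move=> a0; pose u : 'cV[R]_n.+1 := const_mx 1; pose v : 'rV[R]_n.+1 := const_mx 1.
have uv : u *m v = const_mx 1.
  by apply/matrixP => i j; rewrite !mxE big_ord1 !mxE mulr1.
have vu : v *m u = (n.+1%:R)%:M.
  apply/matrixP => i j; rewrite !mxE !ord1 eqxx mulr1n.
  by under eq_bigr do rewrite !mxE mulr1; rewrite sumr_const card_ord.
(* Clearing [v] from the right shows that [\det M] is the wanted determinant; clearing it from the
   left evaluates [a * \det M], and [a] cancels. *)
pose M := block_mx a%:M (- b *: u) v 1%:M.
have detM : \det M = \det (a%:M + const_mx b : 'M_n.+1).
  have e : M *m block_mx 1%:M 0 (- v) 1%:M =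
      block_mx (a%:M + const_mx b) (- b *: u) 0 1%:M.
    rewrite mulmx_block !mulmx1 !mulmx0 mul1mx subrr !add0r.
    congr block_mx; rewrite mulmxN -scalemxAl uv scaleNr opprK; congr (_ + _).
    by apply/matrixP => i j; rewrite !mxE mulr1.
  by have := congr1 determinant e; rewrite det_mulmx det_ublock det_lblock !det1 !mulr1.
have e : block_mx 1%:M 0 (- v) a%:M *m M =
    block_mx a%:M (- b *: u) 0 (a + n.+1%:R * b)%:M.
  rewrite mulmx_block !mul1mx !mul0mx !addr0 mulmx1; congr block_mx.
    by rewrite mulNmx mul_mx_scalar mul_scalar_mx addNr.
  rewrite mulNmx -scalemxAr vu scaleNr opprK scale_scalar_mx addrC.
  by rewrite -raddfD /= mulrC.
have := congr1 determinant e; rewrite det_mulmx det_lblock det_ublock detM !det_scalar.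
rewrite expr1n mul1r expr1 exprS -mulrA => /(mulfI a0) ->.
by rewrite expr1.
Qed.

Lemma det_mx22 (R : comNzRingType) (A : 'M[R]_2) :
  \det A = A 0 0 * A 1 1 - A 0 1 * A 1 0.
Proof.
rewrite (expand_det_row _ ord0) !big_ord_recl big_ord0 /cofactor !det_mx11 !mxE /=.
rewrite expr0 expr1 mul1r mulN1r addr0 mulrN.
by congr (_ * A _ _ - A _ _ * A _ _); apply: val_inj.
Qed.

(* Jacobi's complementary minor formula, freed of inverses. *)
Lemma det_ulsubmx_compl (R : comNzRingType) m k (M B : 'M[R]_(m + k)) (s : R) :
  M *m B = s%:M -> \det (ulsubmx M) * \det B = s ^+ m * \det (drsubmx B).
Proof.
move=> MB.
have e : block_mx (ulsubmx M) (ursubmx M) 0 1%:M *m B =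
    block_mx s%:M 0 (dlsubmx B) (drsubmx B).
  rewrite -[B in LHS]submxK mulmx_block !mul0mx !mul1mx !add0r.
  move: MB; rewrite -[M]submxK -[B]submxK mulmx_block scalar_mx_block.
  by rewrite !submxK => /eq_block_mx[-> -> _ _].
by rewrite -det_scalar -(det_lblock _ (dlsubmx B)) -e det_mulmx det_ublock det1 mulr1.
Qed.

(** * The matrix algebra of a doubly regular tournament *)

Section DoublyRegular.
Variables (n c : nat) (T : rel 'I_n).
Hypothesis tourT : is_tournament T.
Hypothesis nE : n = (4 * c + 3)%N.
Hypothesis comT : forall x y, x != y -> common_out T x y = c%:R.
Hypothesis outT : forall x, outdeg T x = (2 * c + 1)%:R.

Let C : {poly rat} := c%:R.
Let A : 'M[{poly rat}]_n := map_mx polyC (adjmx T).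
Let J : 'M[{poly rat}]_n := const_mx 1.

Definition dr_quad : {poly rat} := 'X^2 + 'X + (C + 1).
Definition dr_lin : {poly rat} := 'X - (2%:R * C + 1).

Lemma dr_adjmx_tr : A^T = J - 1%:M - A.
Proof.
apply/matrixP => i j; rewrite !mxE.
have := adjmx_add tourT j i; rewrite !mxE => e.
have -> : (T j i)%:R = 1 - (i == j)%:R - (T i j)%:R :> rat.
  by rewrite eq_sym -e addrK.
by rewrite !rmorphB /= rmorph1 rmorph_nat.
Qed.

Lemma dr_adjmx_const : A *m J = (2%:R * C + 1) *: J.
Proof.
apply/matrixP => i j; rewrite !mxE mulr1.
transitivity ((outdeg T i)%:P); last by rewrite outT rmorph_nat natrD natrM.
by rewrite rmorph_sum; apply: eq_bigr => k _; rewrite [J _ _]mxE mulr1 [A _ _]mxE.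
Qed.

Lemma dr_adjmx_mul_tr : A *m A^T = C *: J + (C + 1)%:M.
Proof.
apply/matrixP => i j; rewrite !mxE mulr1.
have -> : \sum_k A i k * A^T k j = (common_out T i j)%:P.
  by rewrite rmorph_sum; apply: eq_bigr => k _; rewrite !mxE -polyCM.
have [<-|ij] := eqVneq i j.
  rewrite common_outxx outT rmorph_nat natrD natrM /C [_ *+ true]mulr1n.
  by ring.
by rewrite comT // rmorph_nat mulr0n addr0.
Qed.

(** Substitute [A = J - I - A^T] in the second factor. Left multiplication by [A] thus preserves the
    span of [I], [A] and [J], in which [dr_adj] lies. *)
Lemma dr_adjmx_sqr : A *m A = (C + 1) *: J - A - (C + 1)%:M.
Proof.
have {2}-> : A = J - 1%:M - A^T by rewrite dr_adjmx_tr opprB addrC subrK.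
rewrite !mulmxBr dr_adjmx_const dr_adjmx_mul_tr mulmx1.
by apply/matrixP => i j; rewrite !mxE; ring.
Qed.

Lemma dr_char_poly_mx_mul_tr : char_poly_mx (adjmx T) *m (char_poly_mx (adjmx T))^T =
  dr_quad%:M + const_mx (C - 'X).
Proof.
rewrite /char_poly_mx -/A linearB /= tr_scalar_mx mulmxBl !mulmxBr dr_adjmx_mul_tr.
rewrite !mul_scalar_mx !mul_mx_scalar dr_adjmx_tr.
apply/matrixP => i j; rewrite !mxE /dr_quad.
by case: (i == j); rewrite ?mulr1n ?mulr0n; ring.
Qed.

(** For a doubly regular tournament, this is the adjugate of [X - A] divided by
    [dr_quad ^+ (2 * c)]. *)
Definition dr_adj : 'M[{poly rat}]_n :=
  dr_lin *: (('X + 1)%:M + A) + (C + 1) *: J.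

Lemma dr_char_poly_mx_adj :
  char_poly_mx (adjmx T) *m dr_adj = (dr_quad * dr_lin)%:M.
Proof.
rewrite /char_poly_mx -/A /dr_adj mulmxBl !mulmxDr -!scalemxAr !mulmxDr.
rewrite dr_adjmx_sqr dr_adjmx_const !mul_scalar_mx !mul_mx_scalar.
apply/matrixP => i j; rewrite !mxE /dr_quad /dr_lin.
by case: (i == j); rewrite ?mulr1n ?mulr0n; ring.
Qed.

Lemma dr_quad_monic : dr_quad \is monic.
Proof.
rewrite monicE /dr_quad -addrA lead_coefDl ?lead_coefXn // size_polyXn.
have -> : C + 1 = (c.+1%:R)%:P by rewrite rmorph_nat -natr1.
by rewrite size_XaddC.
Qed.

Lemma dr_lin_monic : dr_lin \is monic.
Proof.
rewrite /dr_lin /C.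
have -> : 2%:R * c%:R + 1 = ((2 * c + 1)%:R)%:P :> {poly rat}.
  by rewrite rmorph_nat natrD natrM.
exact: monicXsubC.
Qed.

Lemma dr_char_poly : char_poly (adjmx T) = dr_lin * dr_quad ^+ (2 * c + 1).
Proof.
have q0 := monic_neq0 dr_quad_monic.
have E_monic : dr_lin * dr_quad ^+ (2 * c + 1) \is monic.
  by rewrite monicMl ?dr_lin_monic // monic_exp ?dr_quad_monic.
have : char_poly (adjmx T) ^+ 2 = (dr_lin * dr_quad ^+ (2 * c + 1)) ^+ 2.
  rewrite expr2 {2}/char_poly -det_tr -det_mulmx dr_char_poly_mx_mul_tr.
  rewrite nE addn3 det_scalar_add_const //.
  rewrite exprMn -exprM [LHS]mulrC; congr (_ * _ ^+ _); last by lia.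
  (* For [n = 4c + 3], [q + n (c - X)] is the square of [X - (2c + 1)]. *)
  by rewrite /dr_quad /dr_lin -addn3 natrD natrM; rewrite /C; ring.
(* Both sides being monic, the sign is [+]. *)
move/eqP; rewrite eqf_sqr => /orP[/eqP -> //|/eqP e].
have := char_poly_monic (adjmx T); rewrite e monicE lead_coefN (monicP E_monic).
by rewrite eq_sym -subr_eq0 opprK -(natrD _ 1 1) pnatr_eq0.
Qed.
End DoublyRegular.

Lemma dr_char_poly_ulsubmx m c (T : rel 'I_(m + 2)) :
  is_tournament T -> (m + 2)%N = (4 * c + 3)%N -> (0 < c)%N ->
  (forall x y, x != y -> common_out T x y = c%:R) ->
  (forall x, outdeg T x = (2 * c + 1)%:R) ->
  char_poly (ulsubmx (adjmx T)) = dr_poly (m + 2).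
Proof.
move=> tourT nE c0 comT outT.
set q := dr_quad c; set l := dr_lin c.
have q0 : q != 0 := monic_neq0 (dr_quad_monic c).
have l0 : l != 0 := monic_neq0 (dr_lin_monic c).
have MB := dr_char_poly_mx_adj tourT comT outT.
set B := dr_adj c T in MB; set M := char_poly_mx _ in MB.
have detM : \det M = l * q ^+ (2 * c + 1) := dr_char_poly tourT nE comT outT.
have ulM : \det (ulsubmx M) = char_poly (ulsubmx (adjmx T)).
  congr (\det _); apply/matrixP => i j; rewrite !mxE.
  by rewrite (inj_eq (@lshift_inj _ _)).
(* With [b = c + 1], the lower right block of [B] has diagonal entries [l (X + 1) + b] and
   off-diagonal entries [l + b] and [b]; its determinant is [l] times this cubic. *)
pose cub : {poly rat} := l * ('X + 1) ^+ 2 + (c%:R + 1) * (2%:R * 'X + 1).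
have det22 : \det (drsubmx B) = l * cub.
  pose r0 := rshift m (0 : 'I_2); pose r1 := rshift m (1 : 'I_2).
  have r01 : r0 != r1 by rewrite (inj_eq (@rshift_inj _ _)).
  rewrite det_mx22 !mxE -/r0 -/r1 !eqxx (eq_sym r1) (negbTE r01).
  rewrite !(negbTE (tourT.1 _)) (tourT.2 _ _ r01) /cub -/l.
  by case: (T r1 r0); rewrite /= ?polyC0 ?polyC1 ?mulr1n ?mulr0n; ring.
(* Jacobi's formula is multiplied by [\det M]; then [\det M * \det B = (q l) ^ (m + 2)] allows
   cancelling [(q l) ^ m]. *)
have key : \det (ulsubmx M) * (q * l) ^+ 2 = (l * cub) * (l * q ^+ (2 * c + 1)).
  have := det_ulsubmx_compl MB; rewrite -/q -/l => e.
  have qlm : (q * l) ^+ m != 0 by rewrite expf_neq0 // mulf_neq0.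
  apply: (mulfI qlm); rewrite -det22 -detM [RHS]mulrA -e.
  have := congr1 determinant MB; rewrite det_mulmx det_scalar exprD -/q -/l => {}e.
  by rewrite mulrCA -e; ring.
have ql2 : (q * l) ^+ 2 != 0 by rewrite expf_neq0 // mulf_neq0.
rewrite -ulM; apply: (mulIf ql2); rewrite key.
have -> : dr_poly (m + 2) = q ^+ (2 * c - 1) * cub.
  rewrite /dr_poly nE.
  (* Natural subtraction is exact here since [c > 0]. *)
  have -> : ((4 * c + 3 - 5)./2 = 2 * c - 1)%N by lia.
  have -> : (4 * c + 3).+1%:R / 4 = c.+1%:R :> rat.
    have -> : ((4 * c + 3).+1 = c.+1 * 4)%N by lia.
    by rewrite natrM mulfK.
  have -> : (4 * c + 3 - 5)%:R / 2 = 2%:R * c%:R - 1 :> rat.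
    have -> : (4 * c + 3 - 5 = (2 * c - 1) * 2)%N by lia.
    by rewrite natrM mulfK // natrB ?natrM //; lia.
  have -> : (4 * c + 3 - 3)%:R / 4 = c%:R :> rat.
    by rewrite addnK mulnC natrM mulfK.
  rewrite !polyCB !polyCM !polyC1 !rmorph_nat -natr1.
  by congr (_ * _); rewrite /cub /l /dr_lin; ring.
have -> : (2 * c + 1 = 2 * c - 1 + 2)%N by lia.
by rewrite exprD; ring.
Qed.

(** * Strict orders *)

(* A nontrivial permutation contributing to the Leibniz formula would yield a
   cycle of [e], hence [e i i] by transitivity. *)
Lemma char_poly_strict_order (R : comNzRingType) k (e : rel 'I_k) (A : 'M[R]_k) :
  irreflexive e -> transitive e -> (forall i j, ~~ e i j -> A i j = 0) ->
  char_poly A = 'X^k.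
Proof.
move=> e_irr e_trans A0; rewrite /char_poly /determinant.
rewrite (bigD1 1%g) //= odd_perm1 expr0 mul1r [X in _ + X]big1 ?addr0 => [|s s1].
  under eq_bigr => i _ do
    rewrite perm1 !mxE eqxx A0 ?e_irr // rmorph0 subr0 mulr1n.
  by rewrite prodr_const card_ord.
have [i si] : exists i, s i != i.
  apply/existsP; rewrite -negb_forall; apply: contra s1 => /forallP si.
  by apply/eqP/permP => i; rewrite perm1; apply/eqP/negPn; rewrite si.
suff [j] : exists j, (s j != j) && ~~ e j (s j).
  case/andP => sj ej; rewrite (bigD1 j) //= !mxE A0 // eq_sym (negbTE sj).
  by rewrite mulr0n rmorph0 subr0 mul0r mulr0.
apply/existsP; apply: contraT; rewrite negb_exists => /forallP H.
have eS j : s j != j -> e j (s j).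
  by move=> sj; have := H j; rewrite sj /= negbK.
have moved t : s ((s ^+ t)%g i) != (s ^+ t)%g i.
  by rewrite -permM -expgSr expgS permM (inj_eq perm_inj).
have ei t : e i ((s ^+ t.+1)%g i).
  elim: t => [|t IH]; first by rewrite expg1 eS.
  by apply: e_trans IH _; rewrite [(s ^+ t.+2)%g]expgSr permM eS.
(* At exponent [#[s]] the orbit of [i] has closed up. *)
have := ei (#[s]%g).-1; rewrite prednK ?order_gt0 // expg_order perm1.
by rewrite e_irr.
Qed.

(** * Relabelling vertices, and conclusion *)

Lemma increasing_inj n k (f : 'I_k -> 'I_n) : increasing f -> injective f.
Proof.
move=> f_inc i j fij; apply: val_inj.
by case: (ltngtP i j) => // /f_inc; rewrite fij ltnn.
Qed.

(** Relabelling along [h] moves the vertices chosen by [f] to the front, turning their principal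
    submatrix into the upper left block. *)
Lemma extend_inj_pair m (f : 'I_m -> 'I_(m + 2)) : injective f ->
  exists2 h : 'I_(m + 2) -> 'I_(m + 2), injective h &
    forall i, h (lshift 2 i) = f i.
Proof.
move=> f_inj; pose S := ~: [set f i | i : 'I_m].
have S2 : #|S| = 2%N.
  by rewrite cardsCs setCK card_imset // !card_ord addKn.
pose g (j : 'I_2) := enum_val (cast_ord (esym S2) j).
have gS j : g j \in S by apply: enum_valP.
pose h k := match split k with inl i => f i | inr j => g j end.
exists h => [k1 k2|i]; last by rewrite /h (unsplitK (inl i)).
have fg i j : f i != g j.
  by apply: contraTneq (gS j) => <-; rewrite inE negbK imset_f.
rewrite /h; case: (split_ordP k1) => i ->; case: (split_ordP k2) => j -> //=.
- by move/f_inj ->.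
- by move/eqP; rewrite (negbTE (fg _ _)).
- by move/esym/eqP; rewrite (negbTE (fg _ _)).
by move/enum_val_inj/cast_ord_inj ->.
Qed.

Lemma relpre_tournament n (h : 'I_n -> 'I_n) (T : rel 'I_n) :
  injective h -> is_tournament T -> is_tournament (relpre h T).
Proof.
move=> h_inj [T0 T1]; split=> [u|u v uv] /=; first exact: T0.
by apply: T1; rewrite (inj_eq h_inj).
Qed.

Lemma char_poly_dr_submx n (T : rel 'I_n) (f : 'I_(n - 2) -> 'I_n) :
  (5 <= n)%N -> is_tournament T -> doubly_regular T -> injective f ->
  char_poly (principal_submx f (adjmx T)) = dr_poly n.
Proof.
move=> n5 tourT [c cE] f_inj; set m := (n - 2)%N in f f_inj *.
have nE : n = (m + 2)%N by rewrite /m; lia.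
clearbody m; subst n.
have [h h_inj hf] := extend_inj_pair f_inj.
have tourT' := relpre_tournament h_inj tourT.
have comT x y : x != y -> common_out (relpre h T) x y = c%:R.
  move=> xy; rewrite -(cE (h x) (h y)) ?(inj_eq h_inj) // -common_out_card.
  by rewrite /common_out [RHS](reindex_inj h_inj); apply: eq_bigr => z _; rewrite !mxE.
have [nc outT] := doubly_regular_outdeg tourT' n5 comT.
rewrite -(dr_char_poly_ulsubmx tourT' nc _ comT outT); last by lia.
by congr char_poly; apply/matrixP => i j; rewrite !mxE /= !hf.
Qed.

Theorem theorem1p1 (n : nat) (T : rel 'I_n) :
  (5 <= n)%N -> is_tournament T ->
  (spectrally_monomorphic (n - 2) (adjmx T) <->
     transitive_tournament T \/ doubly_regular T) /\
  (doubly_regular T ->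
     forall f : 'I_(n - 2) -> 'I_n, increasing f ->
       char_poly (principal_submx f (adjmx T)) = dr_poly n).
Proof.
move=> n5 tourT; split; last first.
  by move=> drT f /increasing_inj; apply: char_poly_dr_submx.
split=> [|[trT|drT] f g f_inc g_inc].
- case: n n5 T tourT => [|[|[|[|[|m]]]]] // _ T tourT mono.
  apply: (eq_cyc3_arc_transitive_or_dr tourT) => x y xy.
  (* The constant [d] is the value at the reference pair [ord0], [ord_max]. *)
  by apply: (eq_cyc3_arc (adjmx_diag tourT) mono xy (_ : ord0 != ord_max)).
- have XE (h : 'I_(n - 2) -> 'I_n) :
      char_poly (principal_submx h (adjmx T)) = 'X^(n - 2).
    apply: (@char_poly_strict_order _ _ (relpre h T)) => [i|j i k|i j] /=.
    + exact/negbTE/tourT.1.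
    + exact: trT.
    + by rewrite !mxE => /negbTE ->.
  by rewrite !XE.
- by rewrite !(char_poly_dr_submx n5 tourT drT) //; apply: increasing_inj.
Qed.
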